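(* For every positive integer $k$, there is a connected graph $G$ of treewidth $2$ such that if $(T, \mathcal{B})$ is a tree decomposition of $G$ and $T$ is a minor of $G$, then $(T, \mathcal{B})$ has width at least $k$.
   Context: Graphs are finite and simple. Let $G$ be a graph, $T$ a tree, and $\mathcal{B} = \{B_x : x \in V(T)\}$ a family of subsets of $V(G)$ indexed by the vertices of $T$. For $v \in V(G)$ let $T_v := T[\{x \in V(T) : v \in B_x\}]$ (induced subgraph). Then $(T,\mathcal{B})$ is a tree decomposition of $G$ if (i) each $T_v$ is a non-empty subtree (connected acyclic subgraph) of $T$, and (ii) for every $uv \in E(G)$, $V(T_u) \cap V(T_v) \neq \emptyset$. The width of $(T,\mathcal{B})$ is $\max_{x \in V(T)} |B_x| - 1$. The treewidth of $G$ is the minimum width of a tree decomposition of $G$. A tree $T$ is a minor of $G$ if there are pairwise disjoint non-empty subtrees $(Q_x : x \in V(T))$ of $G$ such that for each edge $xy \in E(T)$ there is an edge of $G$ with one end in $V(Q_x)$ and the other in $V(Q_y)$. *)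

(* Defs.v *)
From mathcomp Require Import all_boot all_order all_algebra.

Set Implicit Arguments.
Unset Strict Implicit.
Unset Printing Implicit Defensive.

Record sgraph := SGraph {
  vertex :> finType;
  adj : rel vertex;
  adj_sym : symmetric adj;
  adj_irrefl : irreflexive adj }.

(* A subgraph need not be induced: its edge set is any symmetric subset of the
   edges of [G] whose ends lie in its vertex set. *)
Record subgraph (G : sgraph) := Subgraph {
  sverts : {set G};
  sadj : rel G;
  sadj_sym : symmetric sadj;
  sadj_sub : forall x y,
    sadj x y -> [/\ x \in sverts, y \in sverts & adj x y] }.

Section Induced.
Variables (G : sgraph) (A : {set G}).

Definition induced_adj : rel G :=
  fun x y => [&& x \in A, y \in A & adj x y].

Lemma induced_adj_sym : symmetric induced_adj.
Proof. by move=> x y; rewrite /induced_adj adj_sym andbCA. Qed.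

Lemma induced_adj_sub x y :
  induced_adj x y -> [/\ x \in A, y \in A & adj x y].
Proof. by move/and3P. Qed.

Definition induced : subgraph G := Subgraph induced_adj_sym induced_adj_sub.
End Induced.

Definition connected_graph (G : sgraph) : Prop :=
  0 < #|G| /\ forall x y : G, connect (@adj G) x y.

(* [ucycle e [:: x; y]] holds as soon as [x] and [y] are adjacent, so a cycle
   of a graph is a [ucycle] with at least three vertices. *)
Definition acyclic (V : finType) (e : rel V) : Prop :=
  forall c : seq V, ucycle e c -> size c <= 2.

Definition is_tree (T : sgraph) : Prop :=
  connected_graph T /\ acyclic (@adj T).

Definition nonempty_subtree (G : sgraph) (H : subgraph G) : Prop :=
  [/\ sverts H != set0,
      {in sverts H &, forall x y, connect (sadj H) x y}
    & acyclic (sadj H)].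

Section TreeDecomposition.
Variables (G T : sgraph) (B : T -> {set G}).

Definition trace (v : G) : subgraph T := induced [set x : T | v \in B x].

Definition is_tree_decomposition : Prop :=
  [/\ is_tree T,
      forall v : G, nonempty_subtree (trace v)
    & forall u v : G, adj u v ->
        sverts (trace u) :&: sverts (trace v) != set0].

(* Integer-valued, so that the subtraction is not truncated. *)
Definition width : int := ((\max_(x : T) #|B x|)%:Z - 1)%R.
End TreeDecomposition.

(* [w] is the minimum width of a tree decomposition of [G]. *)
Definition is_treewidth (G : sgraph) (w : int) : Prop :=
  (exists (T : sgraph) (B : T -> {set G}),
      is_tree_decomposition B /\ width B = w) /\
  (forall (T : sgraph) (B : T -> {set G}),
      is_tree_decomposition B -> (w <= width B)%R).

(* Minor relation for a tree [T]: the branch sets are subtrees of [G]. *)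
Definition is_tree_minor (T G : sgraph) : Prop :=
  exists Q : T -> subgraph G,
    [/\ forall x, nonempty_subtree (Q x),
        forall x y, x != y -> [disjoint sverts (Q x) & sverts (Q y)]
      & forall x y, adj x y ->
          exists u v, [/\ u \in sverts (Q x), v \in sverts (Q y) & adj u v]].

(* Main.v *)
(** Let [X] be two binary trees of depth [D = k + 1] with corresponding leaves
    joined, and let [G] be [X] with many disjoint stars ("legs") attached to
    each vertex; both graphs have treewidth 2.  The legs of different vertices
    of [X] are of different scales: ordering the vertices, the size of the legs
    grows and their number decreases, both very fast.

    Suppose that [T] is a minor of [G], with branch sets [Q x], and that [B] is a
    decomposition of [G] over [T] with bags of size at most [k].  Among the many
    legs at [a] one avoids all bags at nodes whose branch set meets [X] or a
    leg of a later vertex.  This leg is then hosted by nodes whose branch sets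
    lie in a single leg, which is too small if it is at an earlier vertex.  So
    the part of [T] hosting [a] and its legs meets the part of [T] modelled
    there.

    Now follow the path of [T] joining the nodes so found for the two roots of
    [X].  The corresponding walk in [G] passes, for some leaf, through both
    copies of all its ancestors.  At each ancestor the walk uses one of the two
    children, and the subgraph through the other child joins both copies of the
    ancestor; it is hosted by a subtree of [T] which contains the portion of the
    path between these copies.  All these subtrees share a node, and as the [D]
    subgraphs are disjoint, its bag has at least [D] vertices. *)

Require Import Defs.
From mathcomp Require Import all_boot all_order all_algebra.
From mathcomp Require Import zify.

Set Implicit Arguments.
Unset Strict Implicit.
Unset Printing Implicit Defensive.

(** * Connected vertex sets *)

Definition conn (G : sgraph) (A : {set G}) : Prop :=
  {in A &, forall x y, connect (induced_adj A) x y}.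

Lemma connect_invariant (V : finType) (e : rel V) (P : pred V) x y :
  (forall u v, e u v -> P u -> P v) -> connect e x y -> P x -> P y.
Proof.
move=> eP /connectP[p + ->]; elim: p x => //= z p IHp x /andP[/eP xz /IHp].
by move=> zP Px; apply/zP/xz.
Qed.

Section Connected.
Variable G : sgraph.
Implicit Types (A C : {set G}) (H : subgraph G).

Lemma induced_connect_sym A : connect_sym (induced_adj A).
Proof. exact/sym_connect_sym/induced_adj_sym. Qed.

Lemma induced_connect_sub A C x y :
  A \subset C -> connect (induced_adj A) x y -> connect (induced_adj C) x y.
Proof.
move=> /subsetP AC; apply: connect_sub => u v /and3P[uA vA uv].
by apply: connect1; rewrite /induced_adj !AC.
Qed.

Lemma conn_hub A a :
  (forall x, x \in A -> connect (induced_adj A) x a) -> conn A.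
Proof.
move=> hub x y /hub xa /hub; rewrite induced_connect_sym.
exact: connect_trans.
Qed.

Lemma connU A C u v :
  conn A -> conn C -> u \in A -> v \in C -> adj u v -> conn (A :|: C).
Proof.
move=> cA cC uA vC uv; apply: (@conn_hub _ v) => x /setUP[xA | xC].
  apply: connect_trans (induced_connect_sub (subsetUl _ _) (cA _ _ xA uA)) _.
  by apply: connect1; rewrite /induced_adj !inE uA vC uv orbT.
exact: induced_connect_sub (subsetUr _ _) (cC _ _ xC vC).
Qed.

Lemma conn_invariant A (P : pred G) x y :
    conn A -> x \in A -> y \in A ->
    (forall u v, u \in A -> v \in A -> adj u v -> P u -> P v) ->
  P x -> P y.
Proof.
move=> cA xA yA AP; apply: connect_invariant (cA _ _ xA yA) => u v.
by move=> /and3P[]; apply: AP.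
Qed.

Lemma nonempty_subtree_conn H : nonempty_subtree H -> conn (sverts H).
Proof.
case=> _ cH _ x y xH yH; apply: connect_sub (cH _ _ xH yH) => u v /sadj_sub.
by case=> uH vH uv; apply: connect1; rewrite /induced_adj uH vH.
Qed.

End Connected.

(** * Subtrees of a tree *)

Section Trees.
Variable T : sgraph.
Hypothesis acT : acyclic (@adj T).
Implicit Types (R : {set T}) (p : seq T).

Definition del_edge (x y : T) : rel T :=
  fun u v => adj u v && ~~ ((u == x) && (v == y) || (u == y) && (v == x)).

Lemma del_edge_connect_sym x y : connect_sym (del_edge x y).
Proof.
apply: sym_connect_sym => u v; rewrite /del_edge adj_sym; congr (_ && ~~ _).
by rewrite orbC andbC [(v == y) && _]andbC.
Qed.

(** A path avoiding the edge, once shortened, still has at least two edges, so the edge would close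
    it to a cycle. *)
Lemma tree_edge_bridge x y : adj x y -> ~~ connect (del_edge x y) x y.
Proof.
move=> xy; apply/negP => /connectP[p0 p0P]; case/shortenP: p0P => p pP up _ ylast.
have xp : path (@adj T) x p.
  by apply: sub_path pP => u v /andP[].
have /acT : ucycle (@adj T) (x :: p).
  by rewrite /ucycle up andbT /cycle rcons_path xp -ylast adj_sym.
case: p pP ylast {up xp} => [|z [|//]] /=.
  by move=> _ yx; rewrite yx adj_irrefl in xy.
by rewrite /del_edge andbT => /andP[_ /[swap] <-]; rewrite !eqxx.
Qed.

Lemma conn_del_edge R x y u v :
    conn R -> (x \notin R) || (y \notin R) -> u \in R -> v \in R ->
  connect (del_edge x y) u v.
Proof.
move=> cR xyR uR vR; apply: connect_sub (cR _ _ uR vR) => a b /and3P[aR bR ab].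
apply: connect1; rewrite /del_edge ab /=; apply/negP.
by case/orP=> /andP[/eqP ax /eqP bx]; move: xyR; rewrite -ax -bx aR bR.
Qed.

Lemma path_del_edge x y p :
  path (@adj T) y p -> x \notin y :: p -> connect (del_edge x y) y (last y p).
Proof.
move=> yp xp; apply/connectP; exists p => //.
suff del w : path (@adj T) w p -> x \notin w :: p -> path (del_edge x y) w p.
  exact: del.
elim: p w {yp xp} => //= z p IHp w /andP[wz zp].
rewrite !inE !negb_or => /and3P[xw xz xp]; rewrite IHp ?inE ?negb_or ?xz //.
by rewrite /del_edge wz ![_ == x]eq_sym (negPf xw) (negPf xz) !andbF.
Qed.

(** If the path left [R] at its first edge, [R] and the rest of the path would together bypass that
    edge. *)
Lemma conn_path_sub R x p :
    conn R -> path (@adj T) x p -> uniq (x :: p) ->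
    x \in R -> last x p \in R ->
  {subset x :: p <= R}.
Proof.
move=> cR; elim: p x => [|y p IHp] x /=; first by move=> _ _ xR _ z /[!inE] /eqP->.
case/andP=> xy yp /andP[xp up] xR lR.
suff yR : y \in R.
  by move=> z; rewrite inE => /orP[/eqP->//|]; apply: IHp.
apply: contraT => yR; have /negP[] := tree_edge_bridge xy.
apply: connect_trans (_ : connect _ _ (last y p)) _.
  by apply: conn_del_edge lR => //; rewrite yR orbT.
by rewrite del_edge_connect_sym path_del_edge.
Qed.

(** Follow a path in [R3] from [a] to [b]. If it left [R2] before reaching [R1], the edge used would
    be bypassed through [R2], [c], [R1] and the rest of the path. *)
Lemma subtree_helly3 R1 R2 R3 a b c :
    conn R1 -> conn R2 -> conn R3 ->
    a \in R2 :&: R3 -> b \in R1 :&: R3 -> c \in R1 :&: R2 ->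
  exists x, [/\ x \in R1, x \in R2 & x \in R3].
Proof.
move=> c1 c2 c3 /setIP[a2 a3] /setIP[b1 b3] /setIP[c1' c2'].
have /connectP[p0 p0P] := c3 _ _ a3 b3.
case/shortenP: p0P => p pP up _ bE; rewrite {}bE {b3} in b1.
elim: p a a2 a3 pP up b1 => [|y p IHp] a a2 a3 /=; first by exists a.
case/andP=> /and3P[_ y3 ay] yp /andP[ap up] l1.
have [a1|aN1] := boolP (a \in R1); first by exists a.
have [y2|yN2] := boolP (y \in R2); first exact: IHp yp up l1.
have /negP[] := tree_edge_bridge ay.
apply: connect_trans (_ : connect _ _ c) _.
  by apply: conn_del_edge a2 c2' => //; rewrite yN2 orbT.
apply: connect_trans (_ : connect _ _ (last y p)) _.
  by apply: conn_del_edge c1' l1 => //; rewrite aN1.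
rewrite del_edge_connect_sym path_del_edge //.
by apply: sub_path yp => u v /and3P[].
Qed.

End Trees.

(** * Hosts: the nodes whose bags meet a given vertex set *)

Section Host.
Variables (G T : sgraph) (B : T -> {set G}).
Hypothesis decB : is_tree_decomposition B.

Definition host (C : {set G}) : {set T} := [set x | B x :&: C != set0].

Lemma hostP (C : {set G}) x :
  reflect (exists2 v, v \in B x & v \in C) (x \in host C).
Proof.
rewrite inE; apply: (iffP (set0Pn _)) => [[v /setIP[]]|[v vB vC]]; exists v => //.
exact/setIP.
Qed.

Lemma host_conn (C : {set G}) : conn C -> conn (host C).
Proof.
case: decB => _ tB eB cC x y /hostP[u ux uC] /hostP[v vy vC].
have tr w a b : w \in C -> w \in B a -> w \in B b ->
    connect (induced_adj (host C)) a b.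
  move=> wC wa wb; have [_ /(_ a b)] := tB w; rewrite /= !inE => /(_ wa wb) + _.
  apply: induced_connect_sub; apply/subsetP => z; rewrite inE => wz.
  by apply/hostP; exists w.
(* [P] propagates along edges in [C]: adjacent vertices share a bag, and each trace is connected. *)
pose P w := [forall b, (w \in B b) ==> connect (induced_adj (host C)) x b].
suff : P v by move/forallP/(_ y)/implyP/(_ vy).
apply: (conn_invariant (P := P) cC uC vC) => [a b aC bC /eB /set0Pn[z]|].
  rewrite !inE => /andP[az bz] /forallP/(_ z) /implyP/(_ az) xz.
  apply/forallP => w; apply/implyP => bw; apply: connect_trans xz _.
  exact: tr bC bz bw.
by apply/forallP => b; apply/implyP => ub; apply: tr uC ux ub.
Qed.

Lemma adj_host (A C : {set G}) u v :
  u \in A -> v \in C -> adj u v -> exists x, x \in host A :&: host C.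
Proof.
case: decB => _ _ eB uA vC /eB /set0Pn[x]; rewrite !inE => /andP[ux vx].
by exists x; apply/setIP; split; apply/hostP; [exists u | exists v].
Qed.

(** The three sets model a triangle, so their hosts pairwise intersect; a common node, given by the
    Helly property, has a vertex of each set in its bag. *)
Lemma card_bag_triangle (A1 A2 A3 : {set G}) u12 u21 u13 u31 u23 u32 :
    conn A1 -> conn A2 -> conn A3 ->
    [disjoint A1 & A2] -> [disjoint A1 & A3] -> [disjoint A2 & A3] ->
    [/\ u12 \in A1, u21 \in A2 & adj u12 u21] ->
    [/\ u13 \in A1, u31 \in A3 & adj u13 u31] ->
    [/\ u23 \in A2, u32 \in A3 & adj u23 u32] ->
  exists x, 2 < #|B x|.
Proof.
move=> /host_conn c1 /host_conn c2 /host_conn c3 d12 d13 d23.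
case=> a b /(adj_host a b)[x12 x12P] [{}a {}b] /(adj_host a b)[x13 x13P].
case=> {}a {}b /(adj_host a b)[x23 x23P].
have acT : acyclic (@adj T) by case: decB => -[].
have [x [/hostP[v1 v1B v1A] /hostP[v2 v2B v2A] /hostP[v3 v3B v3A]]] :=
  subtree_helly3 acT c1 c2 c3 x23P x13P x12P.
exists x.
have ne (A C : {set G}) u v :
    [disjoint A & C] -> u \in A -> v \in C -> u != v.
  by move=> dAC uA vC; apply: contraTneq vC => <-; rewrite (disjointFr dAC uA).
have /card_uniqP : uniq [:: v1; v2; v3].
  rewrite /= !inE negb_or (ne _ _ _ _ d12) // (ne _ _ _ _ d13) //.
  by rewrite (ne _ _ _ _ d23).
move=> /= <-; apply/subset_leq_card/subsetP => z.
by rewrite !inE => /or3P[] /eqP->.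
Qed.

End Host.

(** * Trees and decompositions given by parent functions *)

Section ParentTree.
Variables (V : finType) (par : V -> V) (rank : V -> nat) (root : V).
Hypothesis par_rank : forall x, x != root -> rank (par x) < rank x.
Hypothesis par_root : par root = root.

Definition parent_adj : rel V :=
  fun x y => (x != y) && ((par x == y) || (par y == x)).

Lemma parent_adj_sym : symmetric parent_adj.
Proof. by move=> x y; rewrite /parent_adj eq_sym orbC. Qed.

Lemma parent_adj_irrefl : irreflexive parent_adj.
Proof. by move=> x; rewrite /parent_adj eqxx. Qed.

Definition parent_graph : sgraph := SGraph parent_adj_sym parent_adj_irrefl.

Lemma parent_adj_rank x y : parent_adj x y -> rank y <= rank x -> y = par x.
Proof.
case/andP=> xy /orP[/eqP-> // | /eqP yx]; rewrite leqNgt -{1}yx par_rank //.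
by apply: contra_neq xy => yr; rewrite -yx yr par_root.
Qed.

(** Both neighbours on a cycle of a vertex of maximal rank would be its parent. *)
Lemma parent_acyclic : acyclic parent_adj.
Proof.
move=> c /andP[cyc uc]; rewrite leqNgt; apply/negP => sc.
have [x0 x0c] : exists x0, x0 \in c.
  by case: c {cyc uc} sc => // x c _; exists x; rewrite mem_head.
have [x xc xmax] := arg_maxnP (P := [in c]) rank x0c.
have [i s cE] := rot_to xc.
have up y : y \in s -> parent_adj x y -> y = par x.
  move=> ys xy; apply: parent_adj_rank xy (xmax _ _).
  by rewrite -[_ \in _](mem_rot i) cE /= inE ys orbT.
move: cyc uc sc; rewrite -(rot_cycle i) -(rot_uniq i) -(size_rot i) cE.
case: s up {cE} => [|y s] //; case/lastP: s => [|s z] // up /= /andP[xy].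
rewrite rcons_path last_rcons parent_adj_sym => /andP[_ xz].
rewrite inE mem_rcons inE mem_rcons inE.
suff -> : y = z by rewrite eqxx andbF.
by rewrite (up y) ?mem_head // (up z) // inE mem_rcons mem_head orbT.
Qed.

Lemma parent_tree : is_tree parent_graph.
Proof.
split; last exact: parent_acyclic.
split=> [|x y]; first by apply/card_gt0P; exists root.
have toroot z : connect (@adj parent_graph) z root.
  have [n] := ubnP (rank z); elim: n z => // n IHn z zn.
  have [->|zr] := eqVneq z root; first exact: connect0.
  have lt := par_rank zr.
  apply: connect_trans (connect1 _) (IHn (par z) _); last by lia.
  by rewrite /= /parent_adj eqxx andbT; apply: contraTneq lt => <-; rewrite ltnn.
apply: connect_trans (toroot x) _.
by rewrite (sym_connect_sym parent_adj_sym) toroot.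
Qed.

End ParentTree.

(* If every edge joins a vertex to its parent or grandparent in a rooted tree,
   then the tree itself carries a decomposition with these bags. *)
Definition square_bag (G : sgraph) (par : G -> G) (x : G) : {set G} :=
  [set x; par x; par (par x)].

Lemma card_square_bag G par x : #|@square_bag G par x| <= 3.
Proof. by rewrite /square_bag -setUA cardsU1 cards2; lia. Qed.

Lemma square_tree_decomposition (G : sgraph) (par : G -> G) (rank : G -> nat)
    (root : G) :
    (forall x, x != root -> rank (par x) < rank x) -> par root = root ->
    (forall u v, adj u v ->
       v \in square_bag par u \/ u \in square_bag par v) ->
  @is_tree_decomposition G (parent_graph par) (square_bag par).
Proof.
move=> par_rank par_root par_adj.
have treeG := parent_tree par_rank par_root.
have self x : x \in square_bag par x by rewrite !inE eqxx.
split=> // [v | u v /par_adj[] uv]; first 1 last.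
- by apply/set0Pn; exists u; apply/setIP; split; rewrite in_set.
- by apply/set0Pn; exists v; apply/setIP; split; rewrite in_set.
have conn_v : conn (sverts (@trace G (parent_graph par) (square_bag par) v)).
  have step x : v \in square_bag par x -> v \in square_bag par (par x) ->
      connect (@induced_adj (parent_graph par)
                 [set x | v \in square_bag par x]) x (par x).
    move=> vx vpx; have [<-|xp] := eqVneq x (par x); first exact: connect0.
    apply: connect1; rewrite /induced_adj !inE in vx vpx *.
    by rewrite vx vpx /= /parent_adj eqxx xp.
  apply: (@conn_hub (parent_graph par) _ v) => x; rewrite inE => vx.
  (* [v] is [x], its parent or its grandparent; climbing from [x] to [v] stays in the trace. *)
  move: (vx); rewrite {1}/square_bag !inE => /orP[/orP[]|] /eqP vE.
  - by rewrite -vE; apply: connect0.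
  - have vpx : v \in square_bag par (par x) by rewrite vE; apply: self.
    by have := step x vx vpx; rewrite -vE.
  - have vpx : v \in square_bag par (par x) by rewrite vE !inE eqxx !orbT.
    have vppx : v \in square_bag par (par (par x)) by rewrite vE; apply: self.
    by have := connect_trans (step x vx vpx) (step _ vpx vppx); rewrite -vE.
split=> //; first by apply/set0Pn; exists v; rewrite in_set.
case: treeG => _ acG c /andP[cyc uc]; apply: acG; rewrite /ucycle uc andbT.
by case: c cyc {uc} => //= x c; apply: sub_path => a b /and3P[].
Qed.

(** * Counting, and intervals on paths of a tree *)

Lemma card_disjoint_family (I V : finType) (F : I -> {set V}) (X : {set I})
    (U : {set V}) :
    (forall x y, x != y -> [disjoint F x & F y]) ->
    (forall x, x \in X -> F x :&: U != set0) ->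
  #|X| <= #|U|.
Proof.
(* By disjointness [owner] sends every element of [F x] to [x], so its image of [U] covers [X]. *)
move=> dF XU; pose owner v := [pick x | v \in F x].
have Some_injI : injective (@Some I) by move=> x y [].
rewrite -(card_imset _ Some_injI).
apply: leq_trans (leq_imset_card owner U); apply/subset_leq_card/subsetP.
move=> _ /imsetP[x xX ->]; have /set0Pn[v /setIP[vx vU]] := XU _ xX.
apply/imsetP; exists v => //; rewrite /owner; case: pickP => [y vy|/(_ x)].
  apply/esym; congr Some; apply: contraTeq vy => /dF dyx.
  by rewrite (disjointFl dyx).
by rewrite vx.
Qed.

Lemma card_bigcup_le (I V : finType) (F : I -> {set V}) (X : {set I}) k :
  (forall x, #|F x| <= k) -> #|\bigcup_(x in X) F x| <= k * #|X|.
Proof.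
move=> Fk; rewrite mulnC -sum_nat_const.
elim/big_rec2: _ => [|x n A _ An]; first by rewrite cards0.
by rewrite (leq_trans (leq_card_setU _ _)) // leq_add.
Qed.

Lemma conn_between (T : sgraph) (R : {set T}) (zs : seq T) x0 i m j :
    acyclic (@adj T) -> sorted (@adj T) zs -> uniq zs -> conn R ->
    i <= m <= j -> j < size zs -> nth x0 zs i \in R -> nth x0 zs j \in R ->
  nth x0 zs m \in R.
Proof.
move=> acT pz uz cR /andP[im mj] jz iR jR.
pose ys := take (j - i).+1 (drop i zs).
have szy : size ys = (j - i).+1 by rewrite size_take_min size_drop; lia.
have nthy n : n <= j - i -> nth x0 ys n = nth x0 zs (i + n).
  by move=> nji; rewrite nth_take ?nth_drop // ltnS.
have py : sorted (@adj T) ys by apply/take_sorted/drop_sorted.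
have uy : uniq ys by apply/take_uniq/drop_uniq.
have my : nth x0 zs m = nth x0 ys (m - i) by rewrite nthy ?subnKC //; lia.
have : nth x0 ys 0 \in R by rewrite nthy // addn0.
have : nth x0 ys (size ys).-1 \in R by rewrite szy nthy ?subnKC //=; lia.
have : nth x0 ys (m - i) \in ys by rewrite mem_nth // szy; lia.
rewrite nth_last -my; case: ys py uy {szy nthy my} => //= y ys py uy zy lR yR.
exact: (conn_path_sub acT cR py _ yR lR) zy.
Qed.

(** * Glued binary trees with legs *)

Section HairyGraph.
Variable D : nat.

(* A vertex of the two glued binary trees: which copy, and the path from the
   node up to the root, so that the children of [s] are [b :: s]. *)
Definition core := (bool * {bseq D of bool})%type.

Variables (dg sz : core -> nat).

(** [behead] fixes the empty word; the guard keeps the root from being its own child. *)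
Definition child (s t : seq bool) := (s != [::]) && (behead s == t).

Definition core_adj (a b : core) : bool :=
  if a.1 == b.1 then child a.2 b.2 || child b.2 a.2
  else (a.2 == b.2) && (size a.2 == D).

(* Vertex number [i] of leg [j] at the core vertex [a] is [Tagged _ (j, i)]; each
   leg is a star with centre [i = 0], whose centre is adjacent to [a]. *)
Definition hair := {a : core & ('I_(dg a) * 'I_(sz a).+1)%type}.

Definition leg (l : hair) : core * nat := (tag l, val (tagged l).1).

Definition centre (l : hair) : bool := val (tagged l).2 == 0.

Definition hairy_adj (u v : core + hair) : bool :=
  match u, v with
  | inl a, inl b => core_adj a b
  | inl a, inr l | inr l, inl a => (tag l == a) && centre l
  | inr l, inr m => (leg l == leg m) && (centre l != centre m)
  end.

Lemma hairy_adj_sym : symmetric hairy_adj.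
Proof.
case=> [a|l] [b|m] //=.
  rewrite /core_adj eq_sym orbC [a.2 == _]eq_sym; case: eqP => [|_] //.
  by case: eqP => // ->.
by rewrite eq_sym; congr (_ && _); rewrite eq_sym.
Qed.

Lemma hairy_adj_irrefl : irreflexive hairy_adj.
Proof.
case=> [a|l] /=; last by rewrite !eqxx.
rewrite /core_adj eqxx orbb; apply/negP => /andP[].
by case: (val a.2) => //= b s _ /eqP/(congr1 size) /=; lia.
Qed.

Definition hairy : sgraph := SGraph hairy_adj_sym hairy_adj_irrefl.

Definition is_hair (v : hairy) : bool := if v is inr _ then true else false.

Definition base (v : hairy) : core :=
  match v with inl a => a | inr l => tag l end.

(** Words longer than [D] get a default value, hence the bounds on [size s] below. *)
Definition cvert (i : bool) (s : seq bool) : core := (i, insub_bseq D s).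

Lemma insub_bseqK s : size s <= D -> insub_bseq D s = s :> seq bool.
Proof. exact: (@insubdK _ _ {bseq D of bool}). Qed.

Lemma core_ext (a : core) i s : a.1 = i -> val a.2 = s -> a = cvert i s.
Proof.
case: a => j t /= -> <-; congr pair; apply: val_inj => /=.
by rewrite insub_bseqK // size_bseq.
Qed.

Lemma hair_ext (l m : hair) :
  leg l = leg m -> val (tagged l).2 = val (tagged m).2 -> l = m.
Proof.
case: l m => [a [i p]] [b [j q]]; rewrite /leg /= => -[ab ij pq]; subst b.
by congr existT; congr pair; apply: val_inj.
Qed.

(** * A tree decomposition with bags of at most three vertices *)

Definition hub (l : hair) : hair :=
  Tagged (fun a => ('I_(dg a) * 'I_(sz a).+1)%type) ((tagged l).1, ord0).

Definition hairy_root : hairy := inl (cvert false [::]).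

(** The two copies are interleaved. Edges inside a copy then join a vertex to its grandparent, leaf
    edges join a vertex to its parent, and the centre of a leg has both copies of its base as parent
    and grandparent. *)
Definition hairy_par (v : hairy) : hairy :=
  match v with
  | inl (true, s) => inl (false, s)
  | inl (false, s) =>
      if val s == [::] then v else inl (cvert true (behead s))
  | inr l => if centre l then inl (true, (tag l).2) else inr (hub l)
  end.

Definition hairy_rank (v : hairy) : nat :=
  match v with
  | inl (i, s) => (size s).*2 + i
  | inr l => D.+1.*2 + ~~ centre l
  end.

Lemma hairy_par_root : hairy_par hairy_root = hairy_root.
Proof. by rewrite /= insub_bseqK. Qed.

Lemma hairy_par_rank v :
  v != hairy_root -> hairy_rank (hairy_par v) < hairy_rank v.
Proof.
case: v => [[[] s]|l] /=.
- by move=> _; rewrite addn0 addn1.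
- case: (eqVneq (val s) [::]) => [s0 /eqP[]|s0 _ /=].
    by rewrite /hairy_root -(core_ext (a := (false, s)) (erefl _) s0).
  have sD := size_bseq s.
  have s_gt0 : 0 < size s by rewrite lt0n size_eq0.
  have := @insub_bseqK (behead s); rewrite size_behead => ->; last first.
    exact: leq_trans (leq_pred _) sD.
  have dbl m : 0 < m -> m.-1.*2 + 1 < m.*2 + 0 by lia.
  by rewrite size_behead; apply: dbl.
- move=> _; case: (boolP (centre l)) => _ /=; last by rewrite addn0 addn1.
  have dbl m : m <= D -> m.*2 + 1 < D.+1.*2 + 0 by lia.
  exact/dbl/size_bseq.
Qed.

Lemma child_word (s t : {bseq D of bool}) :
  child s t -> (val s == [::]) = false /\ insub_bseq D (behead s) = t.
Proof.
case/andP=> /negPf s0 /eqP st; split=> //; apply: val_inj.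
by rewrite /= insub_bseqK st // size_bseq.
Qed.

Lemma hairy_adj_square (u v : hairy) : adj u v ->
  v \in square_bag hairy_par u \/ u \in square_bag hairy_par v.
Proof.
have centre_hub l : centre (hub l) by [].
have hub_inj l m : leg l = leg m -> centre l -> inr l = inr (hub m) :> hairy.
  by move=> lm /eqP l0; congr inr; apply: hair_ext.
case: u v => [a|l] [b|m] /=.
- rewrite /core_adj; case: a b => [i s] [j t] /=; case: eqP => [<-|ij].
    case/orP=> /child_word[s0 st]; [left | right].
      by case: i; rewrite !inE /= s0 /cvert st eqxx ?orbT.
    by case: i; rewrite !inE /= s0 /cvert st eqxx ?orbT.
  case/andP=> /eqP-> _; case: i j ij => [] [] //= _; [left | right];
  by rewrite !inE eqxx ?orbT.
- case/andP=> /eqP<- m0; right.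
  by rewrite !inE /= m0 /=; case: (tag m) => [[] s] /=; rewrite eqxx ?orbT.
- case/andP=> /eqP<- m0; left.
  by rewrite !inE /= m0 /=; case: (tag l) => [[] s] /=; rewrite eqxx ?orbT.
- case/andP=> /eqP lm.
  have [lc|lc] := boolP (centre l); case mc: (centre m) => // _; [right | left].
    by rewrite (hub_inj _ _ lm lc) !inE /= mc eqxx orbT.
  by rewrite (hub_inj _ _ (esym lm) mc) !inE /= (negPf lc) eqxx orbT.
Qed.

Lemma hairy_decomposition :
  @is_tree_decomposition hairy (parent_graph hairy_par) (square_bag hairy_par).
Proof.
exact: square_tree_decomposition hairy_par_rank hairy_par_root hairy_adj_square.
Qed.

Lemma hairy_adj_base (u v : hairy) : adj u v -> base u != base v ->
  [/\ u = inl (base u), v = inl (base v) & core_adj (base u) (base v)].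
Proof.
case: u v => [a|l] [b|m] //= /andP[/eqP]; rewrite ?eqxx.
- by move=> ->; rewrite eqxx.
- by move=> ->; rewrite eqxx.
- by case=> lm _; rewrite lm eqxx.
Qed.

(* The preimages under [base] of a core vertex and of the part of the core below
   [s]. *)
Definition tuft (a : core) : {set hairy} := [set v | base v == a].

Definition strand (s : seq bool) : {set hairy} :=
  [set v | suffix s (base v).2].

(** * Connectivity of legs, tufts, strands and bypasses *)

Definition leg_set (a : core) (j : nat) : {set hairy} :=
  [set v | if v is inr l then leg l == (a, j) else false].

Lemma leg_conn a j : conn (leg_set a j).
Proof.
move=> x y xL yL.
have [h hP hc] : exists2 h : hair, leg h == (a, j) & centre h.
  by move: xL; rewrite inE; case: x => // l lP; exists (hub l).
have {}hP : inr h \in leg_set a j by rewrite inE.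
suff hubP z : z \in leg_set a j -> connect (induced_adj (leg_set a j)) z (inr h).
  exact: (conn_hub hubP).
move=> zL; have [->|zh] := eqVneq z (inr h); first exact: connect0.
apply: connect1; rewrite /induced_adj zL hP /=.
move: zL hP zh; rewrite !inE; case: z => // l /eqP lP /eqP hP lh /=.
rewrite lP hP eqxx hc /= eqb_id; apply: contra lh => lc.
apply/eqP; congr inr; apply: hair_ext; first by rewrite lP hP.
by rewrite (eqP lc) (eqP hc).
Qed.

Lemma tuft_conn a : conn (tuft a).
Proof.
apply: (@conn_hub hairy (tuft a) (inl a)); case=> [b|l]; rewrite inE /= => /eqP bE.
  by rewrite bE; apply: connect0.
have hl : connect (induced_adj (tuft a)) (inr (hub l)) (inl a).
  by apply: connect1; rewrite /induced_adj !inE /= bE eqxx.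
have [lc|lc] := boolP (centre l).
  by apply: connect1; rewrite /induced_adj !inE /= bE lc !eqxx.
apply: connect_trans (connect1 _) hl.
by rewrite /induced_adj !inE /= bE !eqxx (negPf lc).
Qed.

Lemma suffix_child (s t : seq bool) :
  suffix s t = [|| t == s, suffix (false :: s) t | suffix (true :: s) t].
Proof.
apply/idP/or3P => [/suffixP[r ->{t}]|].
  case/lastP: r => [|r []]; first by apply: Or31.
    by apply: Or33; rewrite cat_rcons suffix_suffix.
  by apply: Or32; rewrite cat_rcons suffix_suffix.
case=> [/eqP->|st|st]; first exact: suffix_refl.
  exact: suffix_trans (suffix_cons _ _) st.
exact: suffix_trans (suffix_cons _ _) st.
Qed.

Lemma suffix_child_excl (b : bool) (s t : seq bool) :
  suffix (b :: s) t -> (t != s) && ~~ suffix (~~ b :: s) t.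
Proof.
move=> st; rewrite andbC; apply/andP; split; last first.
  by apply: contraTneq st => ->; apply/negP => /size_suffix /=; lia.
move: st => /suffixP[r ->]; rewrite suffixE size_cat /= addnK drop_size_cat //.
by rewrite eqseq_cons eqxx andbT; case: b.
Qed.

Lemma core_wordE (a : core) s : size s <= D ->
  (val a.2 == s) = (a == cvert false s) || (a == cvert true s).
Proof.
move=> sD; apply/eqP/orP => [as_|].
  by case: a as_ => -[] t as_; [right | left]; apply/eqP/core_ext.
by case=> /eqP->; rewrite /= insub_bseqK.
Qed.

Lemma core_adj_child i b s : size s < D ->
  core_adj (cvert i s) (cvert i (b :: s)).
Proof.
move=> sD; rewrite /core_adj eqxx /= !insub_bseqK //; last exact: ltnW.
by apply/orP; right; apply/andP; split=> /=.
Qed.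

Lemma core_adj_leaf s : size s = D -> core_adj (cvert false s) (cvert true s).
Proof. by move=> sD; rewrite /core_adj /= insub_bseqK ?sD // !eqxx. Qed.

Lemma core_adj_down i b s (c : core) : size s < D ->
  core_adj (cvert i s) c -> suffix (b :: s) c.2 -> c = cvert i (b :: s).
Proof.
move=> sD; have sK := insub_bseqK (ltnW sD).
rewrite /core_adj /=.
case: eqP => [ic|_] + sc; have /= szc := size_suffix sc; last first.
  by case/andP=> /eqP cs; rewrite -cs sK ltnn in szc.
case/orP=> /andP[c0 /eqP].
  by rewrite sK => cs; rewrite -cs size_behead in szc; lia.
rewrite sK => cs; apply: core_ext; first by [].
move: c0 cs sc {szc}; rewrite /=; case: (bseqval c.2) => //= x w _ ->.
rewrite suffixE /= subnn drop0 => /eqP; exact.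
Qed.

Lemma core_adj_cross b s (a c : core) :
  core_adj a c -> suffix (b :: s) a.2 -> ~~ suffix (~~ b :: s) c.2.
Proof.
have up (u w : seq bool) x : child u w -> suffix (x :: s) w -> suffix (x :: s) u.
  case/andP; case: u => //= y u _ /eqP-> xw.
  exact: suffix_trans xw (suffix_cons _ _).
move=> + sa; have /andP[_ saN] := suffix_child_excl sa.
rewrite /core_adj; case: ifP => _; last by case/andP=> /eqP <-.
case/orP=> ch; first exact: contra (up _ _ _ ch) saN.
by have /andP[_] := suffix_child_excl (up _ _ _ ch sa).
Qed.

(** A connection between the two copies of [s] through the child [b], disjoint from everything below
    the other child. *)
Definition bypass (b : bool) (s : seq bool) : {set hairy} :=
  tuft (cvert false s) :|: strand (b :: s) :|: tuft (cvert true s).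

Lemma strand_bypass b s :
  size s <= D -> strand s = bypass b s :|: strand (~~ b :: s).
Proof.
move=> sD; apply/setP => v; rewrite !inE suffix_child core_wordE //.
have bool_ac p q x y : (p || q) || (x || y) = ((p || x) || q) || y.
  by case: p q x y => [] [] [] [].
by case: b; rewrite bool_ac //= -!orbA; do !bool_congr.
Qed.

Lemma bypass_disjoint b s :
  size s <= D -> [disjoint bypass b s & strand (~~ b :: s)].
Proof.
move=> sD; rewrite disjoint_sym; apply/pred0P => v /=.
rewrite !inE; apply/negP => /andP[/suffix_child_excl /andP[vs]].
rewrite core_wordE // negb_or in vs; case/andP: vs => /negPf-> /negPf->.
by rewrite negbK orbF /= => /negPf->.
Qed.

Lemma bypass_conn b s : size s < D -> conn (strand (b :: s)) -> conn (bypass b s).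
Proof.
move=> sD cS; have edge i := core_adj_child i b sD.
apply: (@connU hairy _ _ (inl (cvert true (b :: s))) (inl (cvert true s))).
- apply: (@connU hairy _ _ (inl (cvert false s)) (inl (cvert false (b :: s)))) => //.
  + exact: tuft_conn.
  + by rewrite !inE.
  + by rewrite inE /= insub_bseqK ?suffix_refl.
  + exact: edge.
- exact: tuft_conn.
- by rewrite !inE /= insub_bseqK ?suffix_refl ?orbT.
- by rewrite !inE.
- by rewrite adj_sym; apply: edge.
Qed.

(** Induction upwards from the leaves, whose strands are two tufts joined by the leaf edge. Above
    them, a strand is a bypass through one child together with the strand of the other. *)
Lemma strand_conn s : size s <= D -> conn (strand s).
Proof.
have [n] := ubnP (D - size s); elim: n s => // n IHn s ltn sD.
have [sE|sN] := eqVneq (size s) D.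
  have -> : strand s = tuft (cvert false s) :|: tuft (cvert true s).
    apply/setP => v; rewrite !inE -core_wordE // eq_sym.
    apply/idP/eqP => [sv|<-]; last exact: suffix_refl.
    have /eqP le0 : size (base v).2 - size s == 0.
      by rewrite subn_eq0 sE size_bseq.
    by move: sv; rewrite suffixE le0 drop0 => /eqP.
  apply: (@connU hairy _ _ (inl (cvert false s)) (inl (cvert true s))).
  - exact: tuft_conn.
  - exact: tuft_conn.
  - by rewrite inE.
  - by rewrite inE.
  - exact: core_adj_leaf.
have {sN}sD' : size s < D by rewrite ltn_neqAle sN.
have IHc b : conn (strand (b :: s)) by apply: IHn => /=; lia.
rewrite (strand_bypass false sD).
apply: (@connU hairy _ _ (inl (cvert false s)) (inl (cvert false (true :: s)))).
- exact: bypass_conn.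
- exact: IHc.
- by rewrite !inE eqxx.
- by rewrite inE /= insub_bseqK ?suffix_refl.
- exact: core_adj_child.
Qed.

Lemma strand_nil : strand [::] = setT.
Proof. by apply/setP => v; rewrite !inE suffix0s. Qed.

Lemma hairy_connected : connected_graph hairy.
Proof.
split=> [|x y]; first by apply/card_gt0P; exists hairy_root.
have := @strand_conn [::] isT; rewrite strand_nil => /(_ x y).
rewrite !inE => /(_ isT isT); apply: connect_sub => u v /and3P[_ _].
exact: connect1.
Qed.

(** * The treewidth is exactly 2 *)

Lemma hairy_width_ge2 (T : sgraph) (B : T -> {set hairy}) :
  0 < D -> is_tree_decomposition B -> (2%:Z <= width B)%R.
Proof.
move=> D0 decB; have D1 (b : bool) : size [:: b] <= D by [].
have [x xB] : exists x, 2 < #|B x|.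
  have sub1 : tuft (cvert false [::]) \subset bypass false [::].
    by apply/subsetP => v; rewrite !inE => ->.
  have sub2 : strand [:: false] \subset bypass false [::].
    by apply/subsetP => v; rewrite !inE => ->; rewrite orbT.
  have sub3 : tuft (cvert true [::]) \subset bypass false [::].
    by apply/subsetP => v; rewrite !inE => ->; rewrite !orbT.
  have dis := @bypass_disjoint false [::] (leq0n D).
  (* A triangle model: the tuft of one root, the strand of one child, and the strand of the other
     child with the tuft of the second root. *)
  apply: (card_bag_triangle decB
    (A1 := tuft (cvert false [::])) (A2 := strand [:: true])
    (A3 := strand [:: false] :|: tuft (cvert true [::]))
    (u12 := inl (cvert false [::])) (u21 := inl (cvert false [:: true]))
    (u13 := inl (cvert false [::])) (u31 := inl (cvert false [:: false]))
    (u23 := inl (cvert true [:: true])) (u32 := inl (cvert true [::]))).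
  - exact: tuft_conn.
  - exact: strand_conn.
  - apply: (@connU hairy _ _ (inl (cvert true [:: false])) (inl (cvert true [::]))).
    + exact: strand_conn.
    + exact: tuft_conn.
    + by rewrite inE /= insub_bseqK.
    + by rewrite inE.
    + by rewrite adj_sym; apply: core_adj_child.
  - exact: disjointWl sub1 dis.
  - apply/pred0P => v /=; rewrite !inE; apply/negP => /andP[/eqP ->].
    by rewrite /= insub_bseqK.
  - by rewrite disjoint_sym (disjointWl _ dis) // subUset sub2.
  - by split; [rewrite inE | rewrite inE /= insub_bseqK | apply: core_adj_child].
  - split; [by rewrite inE | by rewrite !inE /= insub_bseqK | exact: core_adj_child].
  - split; [by rewrite inE /= insub_bseqK | by rewrite !inE eqxx orbT |].
    by rewrite adj_sym; apply: core_adj_child.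
rewrite /width; have := leq_bigmax (F := fun x => #|B x|) x; lia.
Qed.

Lemma hairy_treewidth : 0 < D -> is_treewidth hairy 2%:Z.
Proof.
move=> D0; split; last by move=> T B; apply: hairy_width_ge2.
exists (parent_graph hairy_par), (square_bag hairy_par).
split; first exact: hairy_decomposition.
have := hairy_width_ge2 D0 hairy_decomposition.
suff : \max_(x : parent_graph hairy_par) #|square_bag hairy_par x| <= 3.
  by rewrite /width; lia.
by apply/bigmax_leqP => x _; apply: card_square_bag.
Qed.

Lemma card_leg_set a (j : 'I_(dg a)) : #|leg_set a j| = (sz a).+1.
Proof.
pose f (p : 'I_(sz a).+1) : hairy :=
  inr (Tagged (fun a => ('I_(dg a) * 'I_(sz a).+1)%type) (j, p)).
have f_inj : injective f.
  pose pos (v : hairy) := if v is inr l then val (tagged l).2 else 0.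
  by move=> p q /(congr1 pos) /= pq; apply: val_inj.
rewrite -[RHS]card_ord -(card_imset _ f_inj); apply: eq_card => v.
apply/idP/imsetP => [|[p _ ->]]; last by rewrite inE /= /leg.
rewrite inE; case: v => // l /eqP lj.
suff [p pE] : exists p : 'I_(sz a).+1, val p = val (tagged l).2.
  by exists p => //; congr inr; apply: hair_ext; rewrite ?pE.
by case: l lj => b [i p] [ba _] /=; move: p; rewrite ba => p; exists p.
Qed.

Lemma tuft_exit a (u w : hairy) :
  u \in tuft a -> u != inl a -> adj u w -> w \in tuft a.
Proof.
rewrite !inE => /eqP ua uNa uw; apply: contraNT uNa => wa.
by have [|-> _ _] := hairy_adj_base uw; rewrite ua // eq_sym.
Qed.

(** * Decompositions over a minor *)

Section Minor.
Variables (k : nat) (r : core -> nat) (T : sgraph).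
Variables (B : T -> {set hairy}) (Q : T -> {set hairy}).
Hypothesis r_inj : injective r.

Definition upper (a : core) : {set hairy} :=
  [set v | if v is inr l then r a < r (tag l) else true].

Hypothesis dg_large : forall a, k * #|upper a| < dg a.
Hypothesis sz_large : forall a b, r b < r a -> k * (sz b).+1 < (sz a).+1.
Hypothesis decB : is_tree_decomposition B.
Hypothesis card_bag : forall x, #|B x| <= k.
Hypothesis Q_neq0 : forall x, Q x != set0.
Hypothesis Q_conn : forall x, conn (Q x).
Hypothesis Q_disjoint : forall x y, x != y -> [disjoint Q x & Q y].
Hypothesis Q_adj : forall x y, adj x y ->
  exists u v, [/\ u \in Q x, v \in Q y & adj u v].

Lemma card_host (C : {set hairy}) : #|C| <= k * #|host B C|.
Proof.
apply: leq_trans (card_bigcup_le (host B C) card_bag).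
apply/subset_leq_card/subsetP => v vC; case: decB => _ /(_ v)[/set0Pn[x]].
rewrite inE => vx _ _ _; apply/bigcupP; exists x => //.
by apply/hostP; exists v.
Qed.

Lemma Q_inj x y v : v \in Q x -> v \in Q y -> x = y.
Proof.
by move=> vx; apply: contraTeq => /Q_disjoint dxy; rewrite (disjointFr dxy).
Qed.

(** At most [#|upper a|] of the disjoint branch sets meet [upper a]. The bags at their nodes hold
    fewer vertices than there are legs at [a], so some leg misses them all. *)
Lemma host_unused_leg a : exists j : 'I_(dg a),
  forall x, x \in host B (leg_set a j) -> Q x :&: upper a = set0.
Proof.
pose X := [set x | Q x :&: upper a != set0].
pose W := \bigcup_(x in X) B x.
have cW : #|W| < #|[set: 'I_(dg a)]|.
  rewrite cardsT card_ord; apply: leq_ltn_trans (dg_large a).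
  apply: leq_trans (card_bigcup_le X card_bag) _; rewrite leq_mul2l.
  apply/orP; right; apply: (card_disjoint_family Q_disjoint) => x.
  by rewrite inE.
have /existsP[j /eqP jW] : [exists j : 'I_(dg a), leg_set a j :&: W == set0].
  apply: contraLR cW; rewrite negb_exists -leqNgt => /forallP jW.
  pose F (j : 'I_(dg a)) := leg_set a j.
  apply: (card_disjoint_family (F := F)) => [i j ij|j _].
    apply/pred0P => v /=; rewrite !inE; case: v => //= l.
    apply: contraNF ij => /andP[/eqP -> /eqP[ij]]; apply/eqP; exact: val_inj.
  exact: jW.
exists j => x /hostP[v vx vL]; apply/eqP; apply: contraTT vL => xX.
have vW : v \in W by apply/bigcupP; exists x; rewrite // inE.
by apply/negP => vL; have := in_set0 v; rewrite -jW in_setI vL vW.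
Qed.

Lemma hair_conn_leg (A : {set hairy}) a j v :
    conn A -> (forall u, u \in A -> is_hair u) ->
    v \in A -> v \in leg_set a j ->
  A \subset leg_set a j.
Proof.
move=> cA hA vA vL; apply/subsetP => u uA.
apply: (conn_invariant (P := [in leg_set a j]) cA vA uA) => // {uA}u w.
move=> /hA + /hA; case: u w => // l [] // m _ _ /andP[/eqP lm _].
by rewrite /= !inE lm.
Qed.

Lemma host_tuft_meets a :
  exists2 x, x \in host B (tuft a) & Q x :&: tuft a != set0.
Proof.
have [j jQ] := host_unused_leg a.
pose R := host B (leg_set a j).
have cR : conn R by apply: (host_conn decB); apply: leg_conn.
have RsubY x : x \in R -> x \in host B (tuft a).
  case/hostP=> v vx vL; apply/hostP; exists v => //.
  by move: vL; rewrite !inE; case: v {vx} => // l /eqP[la _]; rewrite /= la.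
have [/existsP[x /andP[xR xQ]]|/existsPn noQ] :=
  boolP [exists x, (x \in R) && (Q x :&: tuft a != set0)].
  by exists x => //; apply: RsubY.
(* Outside [upper a] and the tuft of [a] only legs at vertices of strictly smaller rank remain,
   since [r] is injective. *)
have low x u : x \in R -> u \in Q x ->
    if u is inr l then r (tag l) < r a else false.
  move=> xR ux; have : u \notin upper a.
    by apply/negP => uU; have := in_set0 u; rewrite -(jQ x xR) in_setI ux uU.
  rewrite inE; case: u ux => // l lx; rewrite -leqNgt leq_eqVlt.
  case/predU1P=> // /r_inj la.
  have := noQ x; rewrite xR /= negbK => /eqP Qx0.
  by have := in_set0 (inr l : hairy); rewrite -Qx0 in_setI lx inE /= la eqxx.
have hairQ x : x \in R -> forall u, u \in Q x -> is_hair u.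
  by move=> xR u /(low x u xR); case: u.
have [x0 x0R] : exists x0, x0 \in R.
  apply/set0Pn; rewrite -card_gt0; have := card_host (leg_set a j).
  by rewrite card_leg_set -/R; case: #|R| => //; rewrite muln0.
have [v0 v0Q] := set0Pn _ (Q_neq0 x0).
case: v0 v0Q (low _ _ x0R v0Q) => // l0 l0Q l0a.
pose L := leg_set (tag l0) (leg l0).2.
have l0L : inr l0 \in L by rewrite inE.
(* Branch sets over adjacent nodes are joined by an edge, and edges between leg vertices stay in one
   leg; so the leg [L] contains every branch set over [R]. *)
have QL x : x \in R -> Q x \subset L.
  move=> xR; pose P x := Q x \subset L.
  apply: (conn_invariant (P := P) cR x0R xR) => [x1 x2 x1R x2R /Q_adj|].
    case=> u [v [ux1 vx2 uv]] /subsetP/(_ _ ux1) uL.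
    apply: (hair_conn_leg (@Q_conn x2) (hairQ _ x2R) vx2).
    have := hairQ _ x1R _ ux1; have := hairQ _ x2R _ vx2.
    move: uL uv; case: u v {ux1 vx2} => // l1 [] // l2.
    by rewrite !inE => l1P /andP[/eqP <- _].
  exact: (hair_conn_leg (@Q_conn x0) (hairQ _ x0R) l0Q).
(* [R] has at most one node per vertex of [L], so its bags are too few to cover the larger leg at
   [a]. *)
have cL : #|R| <= (sz (tag l0)).+1.
  rewrite -(card_leg_set (tagged l0).1).
  apply: (card_disjoint_family Q_disjoint) => x /QL /setIidPl ->.
  exact: Q_neq0.
have := card_host (leg_set a j); rewrite card_leg_set leqNgt => /negP[].
apply: leq_ltn_trans (sz_large l0a).
by rewrite leq_mul2l cL orbT.
Qed.

(* A subtree can only leave the nodes modelled inside the legs at [a] through the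
   node whose branch set contains [a]. *)
Lemma core_node_in a y R x x' :
    inl a \in Q y -> conn R -> x \in R -> Q x :&: tuft a != set0 ->
    x' \in R -> ~~ (Q x' \subset tuft a) ->
  y \in R.
Proof.
move=> ay cR xR /set0Pn[v /setIP[vx va]] x'R; apply: contraR => yR.
(* If [y] is outside [R], no branch set over [R] contains the only exit [a] of the tuft; those
   meeting the tuft are trapped in it, and so are those of neighbouring nodes in [R]. *)
have avoid z : z \in R -> inl a \notin Q z.
  by move=> zR; apply: contra yR => az; rewrite (Q_inj ay az).
have fill z w : z \in R -> w \in Q z -> w \in tuft a -> Q z \subset tuft a.
  move=> zR wz wa; apply/subsetP => u uz.
  apply: (conn_invariant (P := [in tuft a]) (@Q_conn z) wz uz) => //.
  move=> u1 u2 u1z _ u12 u1a; apply: tuft_exit u1a _ u12.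
  by apply: contraNneq (avoid _ zR) => <-.
pose P z := Q z \subset tuft a.
apply: (conn_invariant (P := P) cR xR x'R) => [z1 z2 z1R z2R /Q_adj|].
  case=> u1 [u2 [u1z u2z u12]] /subsetP/(_ _ u1z) u1a.
  apply: (fill _ _ z2R u2z); apply: tuft_exit u1a _ u12.
  by apply: contraNneq (avoid _ z1R) => <-.
exact: fill xR vx va.
Qed.

(** * Walks in the graph that follow a path of the tree *)

Section Walk.
Variables (x0 : T) (zs : seq T).
Hypothesis path_zs : sorted (@adj T) zs.
Hypothesis uniq_zs : uniq zs.

(** The value is [size zs] when no branch set on the path contains [v], hence the bounds in
    [step]. *)
Definition idx (v : hairy) : nat := find (fun y => v \in Q y) zs.

(* Monotonicity of [idx] makes every vertex of a sub-walk from [u] to [v] lie in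
   the branch set of a node between those of [u] and [v] on the path [zs]. *)
Definition step (S : {set hairy}) : rel hairy := fun u v =>
  [&& (u \in S) && (v \in S), (idx u < size zs) && (idx v < size zs),
      adj u v & idx u <= idx v].

Lemma idxP v : idx v < size zs -> v \in Q (nth x0 zs (idx v)).
Proof. by rewrite -has_find => /(nth_find x0). Qed.

Lemma idx_nth i v : i < size zs -> v \in Q (nth x0 zs i) -> idx v = i.
Proof.
move=> iz vi; have vz : idx v < size zs.
  by rewrite -has_find; apply/hasP; exists (nth x0 zs i); rewrite ?mem_nth.
apply/eqP; rewrite -(nth_uniq x0 vz iz uniq_zs); apply/eqP.
exact: Q_inj (idxP vz) vi.
Qed.

Lemma step_idx S u v : connect (step S) u v -> idx u <= idx v.
Proof.
move=> uv; apply: (connect_invariant (P := fun w => idx u <= idx w) _ uv) => //.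
by move=> w1 w2 /and4P[_ _ _ le12] le1; apply: leq_trans le12.
Qed.

(** Move inside a branch set by its connectedness, and to the next one by an edge given by the
    minor. *)
Lemma walk_exists i u v :
    i < size zs -> u \in Q (nth x0 zs 0) -> v \in Q (nth x0 zs i) ->
  connect (step setT) u v.
Proof.
have inQ j w1 w2 : j < size zs -> w1 \in Q (nth x0 zs j) ->
    w2 \in Q (nth x0 zs j) -> connect (step setT) w1 w2.
  move=> jz w1j w2j; apply: connect_sub (Q_conn w1j w2j) => a b /and3P[aj bj ab].
  by apply: connect1; rewrite /step !inE (idx_nth jz aj) (idx_nth jz bj) jz ab /=.
elim: i v => [|i IHi] v iz u0 vi; first exact: inQ u0 vi.
have iz' := ltnW iz.
have /Q_adj[a [b [ai bi ab]]] : adj (nth x0 zs i) (nth x0 zs i.+1).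
  by move/(sortedP x0): path_zs; apply.
apply: connect_trans (IHi a iz' u0 ai) _.
apply: connect_trans (connect1 _) (inQ _ _ _ iz bi vi).
by rewrite /step !inE (idx_nth iz' ai) (idx_nth iz bi) iz iz' ab leqnSn.
Qed.

(** An excursion from one copy of [s] to the other through the child [b]; its positions nest with
    those of the excursions further down. *)
Definition crossing (s : seq bool) (b : bool) (lo hi : nat) : Prop :=
  let p : hairy := inl (cvert false s) in
  let q : hairy := inl (cvert true s) in
  let p' : hairy := inl (cvert false (b :: s)) in
  let q' : hairy := inl (cvert true (b :: s)) in
  [/\ idx q < size zs, lo <= idx p <= idx p', idx q' <= idx q <= hi
    & connect (step (strand (b :: s))) p' q'].

(** As [s] is not a leaf, its two copies are not adjacent, and neither are the strands of its two
    children. So an excursion from the first copy stays below one child until it reaches a copy of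
    [s] again, and one of them ends at the second copy. *)
Lemma walk_crossing s u v : size s < D ->
    connect (step (strand s)) u v ->
    u \in tuft (cvert false s) -> v \in tuft (cvert true s) ->
  exists b, crossing s b (idx u) (idx v).
Proof.
move=> sD uv us vt; have sD' := ltnW sD.
pose exiting w b := let q : hairy := inl (cvert true s) in
  let q' : hairy := inl (cvert true (b :: s)) in
  [/\ idx q < size zs, idx q' <= idx q <= idx v
    & connect (step (strand (b :: s))) w q'].
(* Induction from the end of the walk: started below a child [b], it either crosses later or leaves
   to the second copy without visiting the first. *)
pose P w := idx w <= idx v /\
  (w \in tuft (cvert false s) -> exists b, crossing s b (idx w) (idx v)) /\
  (forall b, w \in strand (b :: s) ->
     (exists b, crossing s b (idx w) (idx v)) \/ exiting w b).
suff : P u by case=> _ [/(_ us)].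
case/connectP: uv => p pp vE; move: pp.
have vP : P v.
  split=> //; split=> [vs|b]; rewrite inE in vt.
    by move: vs; rewrite inE (eqP vt).
  by rewrite inE (eqP vt) /= insub_bseqK // => /size_suffix /=; rewrite ltnn.
elim: p u {us} vE => [|w p IHp] u /=; first by move=> <-.
move=> vE /andP[uw /(IHp _ vE)[wv [ws wb]]].
case/and4P: (uw) => /andP[uS wS] /andP[uz wz] adj_uw le_uw.
have weaken b lo : idx u <= lo ->
    crossing s b lo (idx v) -> crossing s b (idx u) (idx v).
  by move=> ulo [? /andP[lo1 lo2] ? ?]; split=> //; rewrite lo2 (leq_trans ulo lo1).
split; first exact: leq_trans wv.
have [b wE] : exists b, [\/ w \in tuft (cvert false s), w \in strand (b :: s)
                         | w \in tuft (cvert true s)].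
  move: (wS); rewrite (strand_bypass true sD') in_setU 2!in_setU.
  case/orP=> [/orP[/orP[]|]|] wE.
  - by exists true; apply: Or31.
  - by exists true; apply: Or32.
  - by exists true; apply: Or33.
  - by exists false; apply: Or32.
split=> [us|c uc].
- case: wE => wE.
  + by have [b' /(weaken _ _ le_uw)] := ws wE; exists b'.
  + have [|uE wE' adj_bw] := hairy_adj_base adj_uw.
      apply: contraTneq wE => buw; rewrite !inE -buw.
      move: us; rewrite inE => /eqP->.
      by rewrite /= insub_bseqK //; apply/negP => /size_suffix /=; rewrite ltnn.
    move: us adj_bw; rewrite inE => /eqP us; rewrite us => adj_bw.
    have bwE : base w = cvert false (b :: s).
      by apply: core_adj_down adj_bw _ => //; move: wE; rewrite inE.
    have [[b' /(weaken _ _ le_uw)]|[qz qle conn_w]] := wb b wE; first by exists b'.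
    by exists b; rewrite /crossing -us -uE -bwE -wE' leqnn le_uw.
  + have [|_ _] := hairy_adj_base adj_uw.
      by move: us wE; rewrite !inE => /eqP-> /eqP->.
    move: us wE; rewrite !inE => /eqP-> /eqP->; rewrite /core_adj /=.
    by rewrite insub_bseqK // => /andP[_ /eqP sE]; rewrite sE ltnn in sD.
- have usuf : suffix (c :: s) (base u).2 by move: uc; rewrite inE.
  have [buw|buw] := eqVneq (base u) (base w).
    have wc : w \in strand (c :: s) by rewrite inE -buw.
    have [[b' /(weaken _ _ le_uw)]|[qz qle conn_w]] := wb c wc.
      by left; exists b'.
    right; split=> //; apply: connect_trans (connect1 _) conn_w.
    by rewrite /step uc wc uz wz adj_uw.
  have [uE wE' adj_bw] := hairy_adj_base adj_uw buw.
  case: wE => wE.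
  + by left; have [b' /(weaken _ _ le_uw)] := ws wE; exists b'.
  + have wsuf : suffix (b :: s) (base w).2 by move: wE; rewrite inE.
    have bc : b = c.
      have := core_adj_cross adj_bw usuf; apply: contraNeq => bc.
      by rewrite (_ : ~~ c = b) //; case: b c bc {wE wsuf usuf uc} => [] [].
    rewrite {b}bc in wE wsuf.
    have [[b' /(weaken _ _ le_uw)]|[qz qle conn_w]] := wb c wE.
      by left; exists b'.
    right; split=> //; apply: connect_trans (connect1 _) conn_w.
    by rewrite /step uc wE uz wz adj_uw.
  + have bw : base w = cvert true s by move: wE; rewrite inE => /eqP.
    have bu : base u = cvert true (c :: s).
      apply: core_adj_down usuf => //.
      rewrite -bw; have /= <- := hairy_adj_sym (inl (base u)) (inl (base w)).
      exact: adj_bw.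
    right; rewrite /exiting -bw -wE' -bu -uE wz le_uw wv; split=> //.
Qed.

Lemma nested_bag n s u v : size s + n = D ->
    connect (step (strand s)) u v ->
    u \in tuft (cvert false s) -> v \in tuft (cvert true s) ->
  exists m, idx u <= m <= idx v /\
    exists A : {set hairy},
      [/\ A \subset strand s, A \subset B (nth x0 zs m) & n <= #|A|].
Proof.
elim: n s u v => [|n IHn] s u v sn uv us vt.
  exists (idx u); rewrite leqnn (step_idx uv); split=> //.
  by exists set0; rewrite !sub0set.
have sD : size s < D by lia.
have [b [qz /andP[lo1 lo2] /andP[hi1 hi2] uv']] := walk_crossing sD uv us vt.
have [|||m [/andP[m1 m2] [A [As AB nA]]]] := IHn (b :: s) _ _ _ uv'.
- by rewrite /= addSnnS.
- by rewrite inE.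
- by rewrite inE.
exists m; split.
  rewrite (leq_trans lo1 (leq_trans lo2 m1)).
  by rewrite (leq_trans m2 (leq_trans hi1 hi2)).
set p : hairy := inl (cvert false s) in lo1 lo2.
set q : hairy := inl (cvert true s) in qz hi1 hi2.
have pm := leq_trans lo2 m1; have mq := leq_trans m2 hi1.
have pz : idx p < size zs by apply: leq_ltn_trans qz; apply: leq_trans mq.
pose C := bypass (~~ b) s.
have cC : conn (host B C).
  by apply: (host_conn decB); apply: bypass_conn => //; apply: strand_conn.
have [x1 x1B x1Q] := host_tuft_meets (cvert false s).
have [x2 x2B x2Q] := host_tuft_meets (cvert true s).
have subC i : tuft (cvert i s) \subset C.
  by apply/subsetP => w; rewrite !inE; case: i => ->; rewrite ?orbT.
have hostC i x : x \in host B (tuft (cvert i s)) -> x \in host B C.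
  case/hostP=> w wx wi; apply/hostP; exists w => //.
  exact: (subsetP (subC i)).
have notsub i x : Q x :&: tuft (cvert i s) != set0 ->
    ~~ (Q x \subset tuft (cvert (~~ i) s)).
  case/set0Pn=> w /setIP[wx wi]; apply/subsetPn; exists w => //.
  by move: wi; rewrite !inE => /eqP->; case: i.
(* [x1] and [x2] both host the bypass, and the branch set of [x2] is not inside the first tuft, so
   [core_node_in] applies at [p]. *)
have pC : nth x0 zs (idx p) \in host B C.
  have x2N := notsub _ _ x2Q.
  exact: core_node_in (idxP pz) cC (hostC _ _ x1B) x1Q (hostC _ _ x2B) x2N.
have qC : nth x0 zs (idx q) \in host B C.
  have x1N := notsub _ _ x1Q.
  exact: core_node_in (idxP qz) cC (hostC _ _ x2B) x2Q (hostC _ _ x1B) x1N.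
have acT : acyclic (@adj T) by case: decB => -[].
have /hostP[w wB wC] : nth x0 zs m \in host B C.
  by apply: (conn_between acT path_zs uniq_zs cC _ qz pC qC); rewrite pm.
have dis := bypass_disjoint (~~ b) (ltnW sD); rewrite negbK in dis.
have sE := strand_bypass (~~ b) (ltnW sD); rewrite negbK in sE.
exists (w |: A); rewrite !subUset !sub1set wB AB sE inE wC; split=> //.
  by apply: subset_trans As _; apply: subsetUr.
rewrite cardsU1 (_ : w \notin A) //.
by apply: contraTN wC => /(subsetP As) wS; rewrite (disjointFl dis wS).
Qed.

End Walk.

Lemma minor_depth : D <= k.
Proof.
have [x1 x1B x1Q] := host_tuft_meets (cvert false [::]).
have [x2 x2B x2Q] := host_tuft_meets (cvert true [::]).
have [u /setIP[ux us]] := set0Pn _ x1Q; have [v /setIP[vx vt]] := set0Pn _ x2Q.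
have [[_ /(_ x1 x2) /connectP[p0 p0P x2E]] _] : is_tree T by case: decB.
move: x2E; case/shortenP: p0P => p pP up _ x2E.
have uv : connect (step (x1 :: p) (strand [::])) u v.
  rewrite strand_nil; apply: (@walk_exists x1 (x1 :: p) pP up (size p)) => //.
  by rewrite (nth_last x1 (x1 :: p)) /= -x2E.
have [m [_ [A [_ AB DA]]]] :=
  @nested_bag x1 (x1 :: p) pP up D [::] u v erefl uv us vt.
exact: leq_trans DA (leq_trans (subset_leq_card AB) (card_bag _)).
Qed.

End Minor.

End HairyGraph.

(** * Choice of the numbers and sizes of the legs *)

Definition core_rank D (a : core D) : nat := enum_rank a.

Lemma core_rank_inj D : injective (@core_rank D).
Proof. by move=> a b /ord_inj/enum_rank_inj. Qed.

Section Sizes.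
Variables (D k : nat).

Let N := #|{: core D}|.

(** The doubling absorbs the extra vertex of each leg, which has [(hair_size a).+1] vertices. *)
Definition hair_size (a : core D) : nat := k.+1.*2 ^ core_rank a.

(** [(k.+1.*2 ^ N).+1] bounds the size of every leg, so the second factor bounds the core together
    with one leg at each core vertex; [k.+1] beats the bag size [k]. *)
Definition hair_factor : nat := k.+1 * (N + N * (k.+1.*2 ^ N).+1).

Definition hair_count (a : core D) : nat := hair_factor ^ (N - core_rank a).

Lemma core_rank_lt a : @core_rank D a < N.
Proof. exact: ltn_ord. Qed.

Lemma hair_size_large (a b : core D) : core_rank b < core_rank a ->
  k * (hair_size b).+1 < (hair_size a).+1.
Proof.
move=> ba; rewrite ltnS /hair_size.
have : k.+1.*2 ^ (core_rank b).+1 <= k.+1.*2 ^ core_rank a.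
  by rewrite leq_pexp2l // double_gt0.
rewrite expnS; have : 0 < k.+1.*2 ^ core_rank b by rewrite expn_gt0.
nia.
Qed.

Lemma hair_count_large (a : core D) :
  k * #|upper hair_count hair_size (@core_rank D) a| < hair_count a.
Proof.
have N_gt0 : 0 < N by apply/card_gt0P; exists a.
have F_gt0 : 0 < hair_factor by rewrite /hair_factor; nia.
set m := N - (core_rank a).+1.
have -> : hair_count a = hair_factor * hair_factor ^ m.
  by rewrite -expnS /hair_count /m subnSK // core_rank_lt.
set F := hair_factor ^ m; have Fm_gt0 : 0 < F by rewrite expn_gt0 F_gt0.
set S := (k.+1.*2 ^ N).+1.
(* Each later vertex has at most [F] legs, each of at most [S] vertices. *)
suff cU : #|upper hair_count hair_size (@core_rank D) a| <= N + N * (F * S).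
  rewrite /hair_factor -/S -mulnA; set Y := _ * F.
  have Y_gt0 : 0 < Y by rewrite muln_gt0 Fm_gt0 addn_gt0 N_gt0.
  have UY : N + N * (F * S) <= Y.
    by rewrite /Y mulnDl [F * S]mulnC mulnA leq_add2r leq_pmulr.
  by rewrite mulSn -[ltnLHS]add0n -addSn leq_add // leq_mul2l (leq_trans cU UY) orbT.
(* The defaults of [insubd] and [inord] are harmless: [small] shows that the indices are in range on
   [upper]. *)
pose code (v : hairy hair_count hair_size) : core D + core D * 'I_F * 'I_S :=
  match v with
  | inl b => inl b
  | inr l => inr (tag l, insubd (Ordinal Fm_gt0) (val (tagged l).1),
                  inord (val (tagged l).2))
  end.
have -> : N + N * (F * S) = #|{: core D + core D * 'I_F * 'I_S}|.
  rewrite card_sum (card_prod (core D * 'I_F)%type) (card_prod (core D)).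
  by rewrite !card_ord mulnA.
apply: leq_trans (max_card (code @: upper hair_count hair_size (@core_rank D) a)).
rewrite card_in_imset // => -[b|l] [c|l']; rewrite !inE //= => al al'.
  by case=> ->.
have small (h : hair hair_count hair_size) : core_rank a < core_rank (tag h) ->
    val (tagged h).1 < F /\ val (tagged h).2 < S.
  move=> ah; split.
    apply: leq_trans (ltn_ord _) _; rewrite leq_pexp2l // /m.
    by move: ah; lia.
  apply: leq_trans (ltn_ord _) _; rewrite ltnS leq_pexp2l ?double_gt0 //.
  exact/ltnW/core_rank_lt.
have [l1 l2] := small l al; have [l1' l2'] := small l' al'.
case=> ll' /(congr1 val); rewrite /= !insubdK // => ll1.
move=> /(congr1 val); rewrite /= !inordK // => ll2.
by congr inr; apply: hair_ext => //; apply: congr2.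
Qed.

End Sizes.

Theorem theorem2 :
  forall k : nat, 0 < k ->
  exists G : sgraph,
    [/\ connected_graph G,
        is_treewidth G 2%:Z
      & forall (T : sgraph) (B : T -> {set G}),
          is_tree_decomposition B -> is_tree_minor T G ->
          (k%:Z <= width B)%R].
Proof.
(* Depth [k.+1] forces a bag with more than [k] vertices, that is, width at least [k]. *)
move=> k _; pose dg := @hair_count k.+1 k; pose sz := @hair_size k.+1 k.
exists (hairy dg sz); split; first exact: hairy_connected.
  exact: hairy_treewidth.
move=> T B decB [Q [Q_tree Q_dis Q_adj]].
have [|small] := ltnP k (\max_x #|B x|); first by rewrite /width; lia.
have /negP[] : ~~ (k.+1 <= k) by rewrite ltnn.
pose V x := sverts (Q x).
apply: (@minor_depth k.+1 dg sz k (@core_rank k.+1) T B V) => //.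
- exact: core_rank_inj.
- exact: hair_count_large.
- exact: hair_size_large.
- by move=> x; apply: leq_trans (leq_bigmax x) small.
- by move=> x; case: (Q_tree x).
- by move=> x; apply/nonempty_subtree_conn/Q_tree.
Qed.
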